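(* Let $\zeta_{24}=e^{2\pi i/24}$ and let $f:\mathbb{Q}\to\mathbb{C}$ be a weight $1$ quantum modular form on $\Gamma_0(2)$ with the multiplier system $\chi$ defined by $$\chi\left(\begin{pmatrix}1&1\\0&1\end{pmatrix}\right)=\chi\left(\begin{pmatrix}1&0\\2&1\end{pmatrix}\right)=\zeta_{24}.$$ For any prime $p$ with $5\le p\le 757$, define $T_p^{\infty}f:\mathbb{Q}\to\mathbb{C}$ by $$T_p^{\infty}f(x)=(-1)^{\frac{p^{2}-1}{24}}f(px)+\frac1p\sum_{j=0}^{p-1}\zeta_{24}^{-pj}f\left(\frac{x+j}{p}\right).$$ Then $T_p^{\infty}f$ is a quantum modular form of weight $1$ on $\Gamma_0(2)$ with multiplier system $\chi^{p}$.
   Context: The matrices $\begin{pmatrix}1&1\\0&1\end{pmatrix}$ and $\begin{pmatrix}1&0\\2&1\end{pmatrix}$ generate $\Gamma_0(2)$, and $\chi:\Gamma_0(2)\to\mathbb{S}^1$ is the group homomorphism with the stated values on them (in particular $\chi(-I)=1$). For a homomorphism $\psi:\Gamma_0(2)\to\mathbb{S}^1$, a function $f:\mathbb{Q}\to\mathbb{C}$ is a quantum modular form of weight $1$ on $\Gamma_0(2)$ with multiplier system $\psi$ if for every $\gamma=\begin{pmatrix}a&b\\c&d\end{pmatrix}\in\Gamma_0(2)$ the function $$h_\gamma(x)=f(x)-\psi(\gamma)^{-1}|cx+d|^{-1}f\left(\frac{ax+b}{cx+d}\right)\qquad(x\in\mathbb{Q},\ cx+d\neq0)$$ can be extended smoothly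 to $\mathbb{R}$ except at finitely many points, i.e. there is a finite set $S\subset\mathbb{Q}$ and a $C^{\infty}$ function on $\mathbb{R}\setminus S$ agreeing with $h_\gamma$ on $\mathbb{Q}\setminus S$. *)

(* Defs.v *)
From HB Require Import structures.
From mathcomp Require Import all_boot all_order all_algebra.
From mathcomp Require Import all_classical all_reals all_analysis.
From mathcomp Require Import complex.

Set Implicit Arguments.
Unset Strict Implicit.
Unset Printing Implicit Defensive.

Import Order.TTheory GRing.Theory Num.Theory.
Import numFieldNormedType.Exports.

Local Open Scope classical_set_scope.
Local Open Scope ring_scope.

Definition mx2 (a b c d : int) : 'M[int]_2 :=
  \matrix_(i < 2, j < 2)
    if i == 0 then (if j == 0 then a else b) else (if j == 0 then c else d).

Definition Gamma0 (N : nat) : {pred 'M[int]_2} :=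
  [pred A | (\det A == 1) && (N %| (A 1 0)%R)%Z].

(* c x + d *)
Definition auto_factor (A : 'M[int]_2) (x : rat) : rat :=
  (A 1 0)%:~R * x + (A 1 1)%:~R.

Definition moebius (A : 'M[int]_2) (x : rat) : rat :=
  ((A 0 0)%:~R * x + (A 0 1)%:~R) / auto_factor A x.

(* A homomorphism from Gamma0 N to the unit circle is represented by a total
   function on integer matrices; its values off Gamma0 N are irrelevant. *)
Definition multiplier_system (R : realType) (N : nat)
    (psi : 'M[int]_2 -> R[i]) : Prop :=
  {in Gamma0 N, forall A, `|psi A| = 1} /\
  {in Gamma0 N &, {morph psi : A B / A *m B >-> A * B}}.

(* C-infinity on an open set D, through the real and imaginary parts; the
   values of g off D do not matter because D is open. *)
Definition smooth_on (R : realType) (D : set R) (g : R -> R[i]) : Prop :=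
  forall (n : nat) (y : R), D y ->
    derivable (derive1n n (fun t => complex.Re (g t))) y 1 /\
    derivable (derive1n n (fun t => complex.Im (g t))) y 1.

Definition period_fun (R : realType) (psi : 'M[int]_2 -> R[i])
    (f : rat -> R[i]) (A : 'M[int]_2) (x : rat) : R[i] :=
  f x - (psi A)^-1 * ratr `|auto_factor A x|^-1 * f (moebius A x).

(* Weight 1. The period function is only meaningful where c x + d != 0, hence the
   condition on x; the pole -d/c may or may not be put in S. *)
Definition quantum_modular (R : realType) (N : nat)
    (psi : 'M[int]_2 -> R[i]) (f : rat -> R[i]) : Prop :=
  multiplier_system N psi /\
  {in Gamma0 N, forall A : 'M[int]_2,
    exists (S : set rat) (g : R -> R[i]),
      [/\ finite_set S,
          smooth_on (~` [set ratr q | q in S]) g &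
          forall x : rat, ~ S x -> auto_factor A x != 0 ->
            g (ratr x) = period_fun psi f A x]}.

Definition zeta24 (R : realType) : R[i] :=
  Complex (cos (2 * pi / 24)) (sin (2 * pi / 24)).

Definition hecke_infty (R : realType) (p : nat) (f : rat -> R[i])
    (x : rat) : R[i] :=
  (-1) ^+ ((p ^ 2 - 1) %/ 24)%N * f (p%:R * x) +
  p%:R^-1 * \sum_(j < p) zeta24 R ^- (p * j) * f ((x + j%:R) / p%:R).

(* Main.v *)
Require Import Defs.
From mathcomp Require Import all_boot all_order all_algebra.
From mathcomp Require Import all_classical all_reals all_analysis.
From mathcomp Require Import complex.
From mathcomp Require Import ring lra zify.
Import Order.TTheory GRing.Theory Num.Theory.
Import numFieldNormedType.Exports.
Local Open Scope ring_scope.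
Set Implicit Arguments.
Unset Strict Implicit.
Unset Printing Implicit Defensive.

(** Write [f | A] for [x |-> |c x + d|^-1 f (A x)] and work modulo functions
    that are smooth off a finite set, so that modularity reads
    [f | A = chi A f].  Up to scalars, [T_p f] is the sum of the [f | delta]
    over representatives [delta] of the integer matrices of determinant [p]
    modulo left multiplication by [Gamma0 2].  Right multiplication by [G]
    permutes the cosets, [delta G = B delta'], and the claim reduces to
    [c_delta chi(B) = chi(G)^p c_delta'], which is needed only for the two
    generators [G] of [Gamma0 2].  It follows from a closed formula: [chi] is
    the multiplier of [eta(2 tau) / eta(tau)], so that [chi A] is [zeta24]
    to a power that is polynomial in the entries of [A]. *)

(** * Arithmetic modulo 24 *)

(* The multiplier of [eta(2 tau) / eta(tau)] at [(a, b; 2 c, 2 e + 1)] is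
   [zeta24] to this power. *)
Definition eta_exponent (a b c e : int) : int :=
  - (a + (2 * e + 1)) * c + b * (2 * e + 1) * (2 * c ^+ 2 + 1)
  + 3 * c * (2 * e + 1) + 6 * e * (e + 1).

Lemma dvdz_mulS_half (n : int) : (2 %| n * (n + 1))%Z.
Proof.
have [k [] ->] : exists k : int, n = 2 * k \/ n = 2 * k + 1.
- by exists (n %/ 2)%Z; lia.
- by rewrite -!mulrA dvdz_mulr.
- by rewrite (_ : _ * _ = 2 * ((2 * k + 1) * (k + 1))) ?dvdz_mulr //; ring.
Qed.

Lemma residue3 (n : int) :
  exists k, [\/ n = 3 * k, n = 3 * k + 1 | n = 3 * k + 2].
Proof.
exists (n %/ 3)%Z.
have [|[|]] : n = 3 * (n %/ 3)%Z \/ n = 3 * (n %/ 3)%Z + 1 \/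
              n = 3 * (n %/ 3)%Z + 2 by lia.
- by constructor 1.
- by constructor 2.
- by constructor 3.
Qed.

(** Modulo 2 the determinant condition makes [a] odd; the second equation is that condition divided
    by 2. *)
Lemma even_det1 (a b c e : int) : a * (2 * e + 1) - b * (2 * c) = 1 ->
  exists2 a', a = 2 * a' + 1 & b * c = 2 * (a' * e) + a' + e.
Proof.
move=> det1.
have [a' aE] : exists a', a = 2 * a' + 1.
  exists ((a - 1) %/ 2)%Z.
  have : 2 * (a * e - b * c) + a = 1 by rewrite -[RHS]det1; ring.
  lia.
exists a' => //.
have : 2 * (2 * (a' * e) + a' + e) - 2 * (b * c) = 0.
  by rewrite -(subrr (1 : int)) -[X in _ = X - _]det1 aE; ring.
by lia.
Qed.

(** This is the effect of right multiplication by [mx2 1 1 0 1]. Up to a multiple of the halved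
    determinant relation the difference is 6 times an integer, and that integer is divisible by 4.
    The division by 3 is Fermat: [2 c ^ 3 + c] vanishes modulo 3. *)
Lemma eta_exponentT a b c e : a * (2 * e + 1) - b * (2 * c) = 1 ->
  (24 %| eta_exponent a (a + b) c (e + c) - (eta_exponent a b c e + 1))%Z.
Proof.
move=> /even_det1[a' -> bcE].
have [w cw] : exists w, c * (2 * c ^+ 2 + 1) = 3 * w.
  have [k [] ->] := residue3 c.
  - by exists (k * (2 * (3 * k) ^+ 2 + 1)); ring.
  - by exists ((3 * k + 1) * (6 * k ^+ 2 + 4 * k + 1)); ring.
  - by exists ((3 * k + 2) * (6 * k ^+ 2 + 8 * k + 3)); ring.
have -> : eta_exponent (2 * a' + 1) (2 * a' + 1 + b) c (e + c) -
    (eta_exponent (2 * a' + 1) b c e + 1) =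
    6 * (c * (2 * c + (2 * e + 1)) + (2 * b + (2 * a' + 1)) * w).
  have -> : 6 * (c * (2 * c + (2 * e + 1)) + (2 * b + (2 * a' + 1)) * w) =
      6 * (c * (2 * c + (2 * e + 1))) + (2 * b + (2 * a' + 1)) * 2 * (3 * w).
    by ring.
  rewrite -cw; apply/eqP; rewrite -subr_eq0 /eta_exponent.
  by rewrite [X in X == _](_ : _ =
    2 * (2 * c ^+ 2 + 1) * (2 * (a' * e) + a' + e - b * c));
    [rewrite bcE subrr mulr0 | ring].
rewrite (_ : 24 = 6 * 4) // dvdz_mul2l //=.
(* Multiplying by 3, a unit modulo 4, allows [3 * w] to be replaced by [c * (2 * c ^+ 2 + 1)]. *)
suff [k kE] : exists k, c * (6 * c + 3 * (2 * e + 1) +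
    (2 * b + (2 * a' + 1)) * (2 * c ^+ 2 + 1)) = 4 * k.
  have : 3 * (c * (2 * c + (2 * e + 1)) + (2 * b + (2 * a' + 1)) * w) = 4 * k.
    rewrite -kE.
    transitivity (3 * (c * (2 * c + (2 * e + 1))) +
                  (2 * b + (2 * a' + 1)) * (3 * w)); first by ring.
    by rewrite -cw; ring.
  by lia.
have [s [cE|cE]] : exists s, c = 2 * s \/ c = 2 * s + 1.
- by exists (c %/ 2)%Z; lia.
- exists (s * (6 * s + 3 * e + 2 + a' + b +
              (2 * b + (2 * a' + 1)) * 4 * s ^+ 2)).
  by rewrite cE; ring.
- exists ((2 * s + 1) * (3 * s + 3 + 3 * (b * s + b - a' * e) +
              2 * (2 * b + 2 * a' + 1) * s * (s + 1))).
  (* For odd [c] the determinant relation forces [a' + b + e] to be even, which supplies the missing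
     factor 2. *)
  have e2 : e = 2 * (b * s + b - a' * e) - a' - b.
    have : b * c = 2 * (b * s) + b by rewrite cE; ring.
    rewrite bcE mulrBr mulrDr; lia.
  by rewrite cE {1}e2; ring.
Qed.

(** This is the effect of right multiplication by [mx2 1 0 2 1]. Up to a multiple of the halved
    determinant relation the difference is [8 * (2 * a' + 1 + b) * (e * (e + 1) * (2 * e + 1))], and
    3 divides the last product. *)
Lemma eta_exponentV a b c e : a * (2 * e + 1) - b * (2 * c) = 1 ->
  (24 %| eta_exponent (a + 2 * b) b (c + (2 * e + 1)) e -
         (eta_exponent a b c e + 1))%Z.
Proof.
move=> /even_det1[a' -> bcE].
have [w ew] : exists w, e * (e + 1) * (2 * e + 1) = 3 * w.
  have [k [] ->] := residue3 e.
  - by exists (k * (3 * k + 1) * (2 * (3 * k) + 1)); ring.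
  - by exists ((3 * k + 1) * (3 * k + 2) * (2 * k + 1)); ring.
  - by exists ((3 * k + 2) * (k + 1) * (6 * k + 5)); ring.
apply/dvdzP; exists (w * (2 * a' + 1 + b)).
have -> : w * (2 * a' + 1 + b) * 24 = 8 * (2 * a' + 1 + b) * (3 * w) by ring.
rewrite -ew; apply/eqP; rewrite -subr_eq0 /eta_exponent.
by rewrite [X in X == _](_ : _ =
  2 * (2 * (2 * e + 1) ^+ 2 - 1) * (b * c - (2 * (a' * e) + a' + e)));
  [rewrite bcE subrr mulr0 | ring].
Qed.

(** This is the congruence needed when [mx2 1 0 2 1] sends the coset of [j] to that of [k]. As
    [p ^ 2 = 1] modulo 24, [m] is congruent to [p * (m * p)] and can be eliminated. What remains is
    6 times the product of the even numbers [k * (k - 1)] and [p + 1 + 2 * j * p]. *)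
Lemma eta_exponent_coset p j k m : (24 %| p ^+ 2 - 1)%Z ->
  m * p = j - k * (1 + 2 * j) ->
  (24 %| eta_exponent (1 + 2 * j) m p (- k) - p * (1 + j - k))%Z.
Proof.
move=> /dvdzP[q qE] mp.
have p2 : p ^+ 2 = q * 24 + 1 by rewrite -qE; ring.
have [t tE] : exists t, k * (k - 1) = 2 * t.
  have /dvdzP[t tE] := dvdz_mulS_half (k - 1).
  by exists t; rewrite [RHS]mulrC -tE; ring.
have [s sE] : exists s, p = 2 * s + 1.
  have /dvdzP[r] := dvdz_mulS_half p.
  rewrite mulrDr mulr1 -expr2 p2 => rE.
  by exists (r - q * 12 - 1); lia.
have m3 : 3 * m = 3 * p * (j - k * (1 + 2 * j)) - 72 * (m * q).
  transitivity (3 * m * p ^+ 2 - 72 * (m * q)); first by rewrite p2; ring.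
  by rewrite -mp; ring.
apply/dvdzP; exists (t * (s + 1 + j * p) - q * m * (1 - 2 * k)).
have -> : (t * (s + 1 + j * p) - q * m * (1 - 2 * k)) * 24 =
   6 * (2 * t) * ((2 * s + 1) + 1 + 2 * j * p) - 24 * q * m * (1 - 2 * k).
  by ring.
rewrite -tE -sE.
have -> : eta_exponent (1 + 2 * j) m p (- k) =
    - (1 + 2 * j + (2 * - k + 1)) * p
    + (3 * m * (2 * - k + 1) + 48 * (m * q) * (2 * - k + 1))
    + 3 * p * (2 * - k + 1) + 6 * - k * (- k + 1).
  by rewrite /eta_exponent p2; ring.
by rewrite m3; ring.
Qed.

(** * The group [Gamma0 2] *)

Lemma mx2E (A : 'M[int]_2) : A = mx2 (A 0 0) (A 0 1) (A 1 0) (A 1 1).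
Proof.
apply/matrixP => i j; rewrite mxE.
by case: i j => [[|[|i]] //= li] [[|[|j]] //= lj] //=; congr (A _ _);
  apply/val_inj.
Qed.

Lemma mul_mx2 a b c d a' b' c' d' :
  mx2 a b c d *m mx2 a' b' c' d' =
  mx2 (a * a' + b * c') (a * b' + b * d') (c * a' + d * c') (c * b' + d * d').
Proof.
apply/matrixP => i j; rewrite !mxE big_ord_recl big_ord1 !mxE /=.
by case: eqP; case: eqP.
Qed.

Lemma mx2_inj a b c d a' b' c' d' : mx2 a b c d = mx2 a' b' c' d' ->
  [/\ a = a', b = b', c = c' & d = d'].
Proof.
move/matrixP => E; split;
  [have := E 0 0 | have := E 0 1 | have := E 1 0 | have := E 1 1];
  by rewrite !mxE.
Qed.

Lemma det_mx2 a b c d : \det (mx2 a b c d) = a * d - b * c.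
Proof.
rewrite (expand_det_row _ 0) big_ord_recl big_ord1 /cofactor !det_mx11 !mxE /=.
by rewrite expr0 expr1 mul1r mulN1r mulrN.
Qed.

Lemma mx2_1 : mx2 1 0 0 1 = 1%:M.
Proof.
by apply/matrixP => i j; rewrite !mxE;
  case: i j => [[|[|i]] //= li] [[|[|j]] //= lj].
Qed.

Lemma Gamma0P N a b c d :
  (mx2 a b c d \in Gamma0 N) = (a * d - b * c == 1) && (N %| c)%Z.
Proof. by rewrite unfold_in det_mx2 !mxE. Qed.

Lemma Gamma0M N : {in Gamma0 N &, forall A B, A *m B \in Gamma0 N}.
Proof.
have GammaE A : (A \in Gamma0 N) = (\det A == 1) && (N %| (A 1 0)%R)%Z by [].
move=> A B; rewrite !GammaE det_mulmx.
move=> /andP[/eqP-> cA] /andP[/eqP-> cB]; rewrite mulr1 eqxx andTb.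
have -> : (A *m B) 1 0 = A 1 0 * B 0 0 + A 1 1 * B 1 0.
  by rewrite [in LHS](mx2E A) [in LHS](mx2E B) mul_mx2 mxE.
by apply: rpredD; [exact: dvdz_mulr | exact: dvdz_mull].
Qed.

(* Euclidean descent on [|c| + |d|]: as [c] is even and [d] is odd, one of the
   four factors decreases it as long as [c != 0]. *)
Lemma Gamma0_2_ind (P : 'M[int]_2 -> Prop) :
  P 1%:M ->
  {in Gamma0 2, forall A, P A -> P (A *m mx2 1 1 0 1)} ->
  {in Gamma0 2, forall A, P A -> P (A *m mx2 1 (-1) 0 1)} ->
  {in Gamma0 2, forall A, P A -> P (A *m mx2 1 0 2 1)} ->
  {in Gamma0 2, forall A, P A -> P (A *m mx2 1 0 (-2) 1)} ->
  {in Gamma0 2, forall A, P A}.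
Proof.
move=> P1 PT PTi PV PVi.
(* Here [s] is a sign, and the matrix is [s] times the power [s * b] of [mx2 1 1 0 1]; the induction
   runs over that power. *)
have Pdiag (s : int) : s * s = 1 -> P (mx2 s 0 0 s) ->
    forall b, P (mx2 s b 0 s).
  move=> ss Ps b; have -> : b = s * (s * b) by rewrite mulrA ss mul1r.
  have Gs z : mx2 s (s * z) 0 s \in Gamma0 2 by rewrite Gamma0P mulr0 subr0 ss.
  elim/int_ind: (s * b) => [|n IHn|n IHn]; first by rewrite mulr0.
  - have := PT _ (Gs _) IHn.
    rewrite mul_mx2 !(mulr1, mul0r, mulr0, addr0, add0r).
    by rewrite -[in n.+1%:Z]addn1 PoszD mulrDr mulr1 addrC.
  - have := PTi _ (Gs _) IHn.
    rewrite mul_mx2 !(mulr1, mul0r, mulr0, addr0, add0r).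
    by rewrite -[in n.+1%:Z]addn1 PoszD opprD mulrDr addrC.
(* Minus the identity is the square of [mx2 1 (-1) 0 1 *m mx2 1 0 2 1]. *)
have PN1 : P (mx2 (-1) 0 0 (-1)).
  have H A : A \in Gamma0 2 -> P A ->
      P (A *m mx2 1 (-1) 0 1 *m mx2 1 0 2 1).
    by move=> GA PA; apply: PV; [apply: Gamma0M; rewrite ?Gamma0P | exact: PTi].
  have G1 : 1%:M \in Gamma0 2 by rewrite -mx2_1 Gamma0P.
  have := H _ _ (H _ G1 P1); rewrite mul1mx !mul_mx2; apply.
  by rewrite Gamma0P.
rewrite -mx2_1 in P1.
move=> A; rewrite (mx2E A).
move: (A 0 0) (A 0 1) (A 1 0) (A 1 1) => {A} a b c d.
have [n] := ubnP (`|c| + `|d|)%N.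
elim: n a b c d => // n IHn a b c d cdn Gabcd.
have /andP[/eqP det1 c_even] : (a * d - b * c == 1) && (2 %| c)%Z.
  by rewrite -Gamma0P.
have d_odd : ~~ (2 %| d)%Z.
  apply/negP => d_even.
  have : (2 %| a * d - b * c)%Z by apply: rpredB; exact: dvdz_mull.
  by rewrite det1.
have [c0|c_neq0] := eqVneq c 0.
  have [[aE dE]|[aE dE]] : (a = 1 /\ d = 1) \/ (a = -1 /\ d = -1).
  - have : a * d = 1 by rewrite -[RHS]det1 c0; ring.
    move=> ad; have /eqP := congr1 absz ad.
    rewrite abszM muln_eq1 => /andP[a1 d1].
    have [aE|aE] : a = 1 \/ a = -1 by move: a1; clear; lia.
      by move: ad; rewrite aE; clear; lia.
    by move: ad; rewrite aE; clear; lia.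
  - by rewrite aE dE c0; apply: Pdiag.
  - by rewrite aE dE c0; apply: Pdiag.
have step (B C : 'M[int]_2) a' b' c' d' :
    {in Gamma0 2, forall A, P A -> P (A *m C)} -> B *m C = 1%:M ->
    B \in Gamma0 2 -> mx2 a b c d *m B = mx2 a' b' c' d' ->
    (`|c'| + `|d'| < n)%N -> P (mx2 a b c d).
  move=> PC BC1 GB E lt_n; have := Gamma0M Gabcd GB; rewrite E => G'.
  by have := PC _ G' (IHn _ _ _ _ lt_n G'); rewrite -E -mulmxA BC1 mulmx1.
(* Parity excludes [|c| = |d|], where replacing [c] by [c - 2 d] or [c + 2 d] could fail to decrease
   it. *)
have cd_neq : `|c|%N != `|d|%N by move: c_even d_odd; clear; lia.
have d_neq0 : d != 0 by move: d_odd; clear; lia.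
have TTi : mx2 1 1 0 1 *m mx2 1 (-1) 0 1 = 1%:M by rewrite mul_mx2 -mx2_1.
have TiT : mx2 1 (-1) 0 1 *m mx2 1 1 0 1 = 1%:M by rewrite mul_mx2 -mx2_1.
have VVi : mx2 1 0 2 1 *m mx2 1 0 (-2) 1 = 1%:M by rewrite mul_mx2 -mx2_1.
have ViV : mx2 1 0 (-2) 1 *m mx2 1 0 2 1 = 1%:M by rewrite mul_mx2 -mx2_1.
(* The larger of [|c|] and [|d|] is reduced, [d] by [c] or [c] by [2 d]; the sign of [c * d] decides
   between adding and subtracting. *)
have [cd|dc] := ltnP `|c|%N `|d|%N.
- have [cd_pos|cd_neg] := leP 0 (c * d).
  + apply: (step _ _ _ _ _ _ PT TiT); [by rewrite Gamma0P|exact: mul_mx2|].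
    by move: cdn cd cd_pos c_neq0; clear; nia.
  + apply: (step _ _ _ _ _ _ PTi TTi); [by rewrite Gamma0P|exact: mul_mx2|].
    by move: cdn cd cd_neg c_neq0; clear; nia.
- have [cd_pos|cd_neg] := leP 0 (c * d).
  + apply: (step _ _ _ _ _ _ PV ViV); [by rewrite Gamma0P|exact: mul_mx2|].
    by move: cdn dc cd_pos c_neq0 d_neq0 cd_neq; clear; nia.
  + apply: (step _ _ _ _ _ _ PVi VVi); [by rewrite Gamma0P|exact: mul_mx2|].
    by move: cdn dc cd_neg c_neq0 d_neq0 cd_neq; clear; nia.
Qed.

(** * The multiplier system [chi] *)

Lemma de_moivre (R : realType) (x : R) n :
  Complex (cos x) (sin x) ^+ n = Complex (cos (x *+ n)) (sin (x *+ n)).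
Proof.
elim: n => [|n IHn]; first by rewrite expr0 mulr0n cos0 sin0.
rewrite exprS IHn mulrS cosD sinD; simpc.
by congr Complex; rewrite addrC.
Qed.

Lemma zeta24_12 (R : realType) : zeta24 R ^+ 12 = -1.
Proof.
rewrite /zeta24 de_moivre (_ : _ *+ 12 = pi); last by field.
by rewrite cospi sinpi; simpc.
Qed.

Lemma zeta24_neq0 (R : realType) : zeta24 R != 0.
Proof.
apply/negP => /eqP z0; have := zeta24_12 R; rewrite z0 expr0n /= => /eqP.
by rewrite eq_sym oppr_eq0 oner_eq0.
Qed.

Lemma zeta24_modX (R : realType) (m n : int) :
  (24 %| m - n)%Z -> zeta24 R ^ m = zeta24 R ^ n.
Proof.
move=> /dvdzP[q mn]; rewrite -[m](subrK n) mn mulrC.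
rewrite expfzDr ?zeta24_neq0 // -exprz_exp.
have -> : zeta24 R ^ 24%Z = 1.
  by rewrite -exprnP (exprM _ 12 2) zeta24_12 sqrrN expr1n.
by rewrite exp1rz mul1r.
Qed.

Lemma multiplier_system1 (R : realType) N (psi : 'M[int]_2 -> R[i]) :
  multiplier_system N psi -> psi 1%:M = 1.
Proof.
move=> [psi_norm psiM]; have G1 : 1%:M \in Gamma0 N.
  by rewrite -mx2_1 Gamma0P dvdz0.
have psi_neq0 : psi 1%:M != 0 by rewrite -normr_gt0 psi_norm ?ltr01.
by apply: (mulfI psi_neq0); rewrite -psiM // mulmx1 mulr1.
Qed.

Section EtaMultiplier.
Variables (R : realType) (chi : 'M[int]_2 -> R[i]).
Hypotheses (chi_mult : multiplier_system 2 chi)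
  (chi_T : chi (mx2 1 1 0 1) = zeta24 R)
  (chi_V : chi (mx2 1 0 2 1) = zeta24 R).
Let z := zeta24 R.

(** Both sides are 1 at the identity, and right multiplication by a generator or its inverse
    multiplies both by [z] or by its inverse, so induction over the group applies. *)
Lemma chi_etaE a b c e : a * (2 * e + 1) - b * (2 * c) = 1 ->
  chi (mx2 a b (2 * c) (2 * e + 1)) = z ^ eta_exponent a b c e.
Proof.
have [_ chiM] := chi_mult; have chi1 := multiplier_system1 chi_mult.
pose P (A : 'M[int]_2) := forall a b c e,
  A = mx2 a b (2 * c) (2 * e + 1) -> chi A = z ^ eta_exponent a b c e.
have z_neq0 : z != 0 := zeta24_neq0 R.
have chiV (A B : 'M[int]_2) : A \in Gamma0 2 -> B \in Gamma0 2 ->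
    A *m B = 1%:M -> chi A = z -> chi B = z ^ (-1 : int).
  move=> GA GB AB chiA; apply: (mulfI z_neq0).
  by rewrite -{1}chiA -chiM // AB chi1 exprN1 divff.
have shift (m n k : int) : (24 %| m - (n + k))%Z -> z ^ n * z ^ k = z ^ m.
  by move=> mnk; rewrite -expfzDr //; apply/esym/zeta24_modX.
suff PG : {in Gamma0 2, forall A, P A}.
  move=> det1; apply: (PG _ _ _ _ _ _ erefl).
  by rewrite Gamma0P det1 eqxx dvdz_mulr.
clear a b c e.
have prep A B : A \in Gamma0 2 -> B \in Gamma0 2 -> forall a b c e,
    A *m B = mx2 a b (2 * c) (2 * e + 1) ->
    a * (2 * e + 1) - b * (2 * c) = 1 /\
    chi (mx2 a b (2 * c) (2 * e + 1)) = chi A * chi B.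
  move=> GA GB a b c e AB; have := Gamma0M GA GB.
  rewrite AB Gamma0P => /andP[/eqP det1 _].
  by split=> //; rewrite -AB chiM.
have cancel_r (A B C D : 'M[int]_2) : B *m C = 1%:M -> A *m B = D -> A = D *m C.
  by move=> BC <-; rewrite -mulmxA BC mulmx1.
have GT : mx2 1 1 0 1 \in Gamma0 2 by rewrite Gamma0P.
have GTi : mx2 1 (-1) 0 1 \in Gamma0 2 by rewrite Gamma0P.
have GV : mx2 1 0 2 1 \in Gamma0 2 by rewrite Gamma0P.
have GVi : mx2 1 0 (-2) 1 \in Gamma0 2 by rewrite Gamma0P.
have TTi : mx2 1 1 0 1 *m mx2 1 (-1) 0 1 = 1%:M by rewrite mul_mx2 -mx2_1.
have TiT : mx2 1 (-1) 0 1 *m mx2 1 1 0 1 = 1%:M by rewrite mul_mx2 -mx2_1.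
have VVi : mx2 1 0 2 1 *m mx2 1 0 (-2) 1 = 1%:M by rewrite mul_mx2 -mx2_1.
have ViV : mx2 1 0 (-2) 1 *m mx2 1 0 2 1 = 1%:M by rewrite mul_mx2 -mx2_1.
apply: Gamma0_2_ind.
- move=> a b c e; rewrite -mx2_1 => /mx2_inj[<- <- c0 e0].
  have -> : c = 0 by move: c0; clear; lia.
  have -> : e = 0 by move: e0; clear; lia.
  by rewrite mx2_1 chi1.
- move=> A GA PA a b c e AB; rewrite AB;
    have [det1 ->] := prep _ _ GA GT _ _ _ _ AB.
  have AE := cancel_r _ _ _ _ TTi AB; rewrite mul_mx2 in AE.
  have {}AE : A = mx2 a (b - a) (2 * c) (2 * (e - c) + 1).
    by rewrite AE; congr mx2; ring.
  rewrite (PA _ _ _ _ AE) chi_T -[X in _ * X = _]expr1z; apply: shift.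
  rewrite -{1}[b](subrKC a) -{1}[e](subrK c); apply: eta_exponentT.
  by rewrite -[RHS]det1; ring.
- move=> A GA PA a b c e AB; rewrite AB;
    have [det1 ->] := prep _ _ GA GTi _ _ _ _ AB.
  have AE := cancel_r _ _ _ _ TiT AB; rewrite mul_mx2 in AE.
  have {}AE : A = mx2 a (a + b) (2 * c) (2 * (e + c) + 1).
    by rewrite AE; congr mx2; ring.
  rewrite (PA _ _ _ _ AE) (chiV _ _ GT GTi TTi chi_T); apply: shift.
  (* The congruence is applied to the product, whose multiple by [mx2 1 1 0 1] is [A]; hence the
     opposite quotient. *)
  have /dvdzP[q qE] := eta_exponentT det1; apply/dvdzP; exists (- q).
  by rewrite mulNr -qE; ring.
- move=> A GA PA a b c e AB; rewrite AB;
    have [det1 ->] := prep _ _ GA GV _ _ _ _ AB.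
  have AE := cancel_r _ _ _ _ VVi AB; rewrite mul_mx2 in AE.
  have {}AE : A = mx2 (a - 2 * b) b (2 * (c - (2 * e + 1))) (2 * e + 1).
    by rewrite AE; congr mx2; ring.
  rewrite (PA _ _ _ _ AE) chi_V -[X in _ * X = _]expr1z; apply: shift.
  rewrite -{1}[a](subrK (2 * b)) -{1}[c](subrK (2 * e + 1)).
  apply: eta_exponentV.
  by rewrite -[RHS]det1; ring.
- move=> A GA PA a b c e AB; rewrite AB;
    have [det1 ->] := prep _ _ GA GVi _ _ _ _ AB.
  have AE := cancel_r _ _ _ _ ViV AB; rewrite mul_mx2 in AE.
  have {}AE : A = mx2 (a + 2 * b) b (2 * (c + (2 * e + 1))) (2 * e + 1).
    by rewrite AE; congr mx2; ring.
  rewrite (PA _ _ _ _ AE) (chiV _ _ GV GVi VVi chi_V); apply: shift.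
  have /dvdzP[q qE] := eta_exponentV det1; apply/dvdzP; exists (- q).
  by rewrite mulNr -qE; ring.
Qed.

End EtaMultiplier.

(** A prime at least 5 is a unit modulo 24, and every unit modulo 24 has square 1, as a check of the
    24 residues shows. *)
Lemma sqr_mod24 p : prime p -> (5 <= p)%N -> (24 %| p%:Z ^+ 2 - 1)%Z.
Proof.
move=> p_pr p5.
have co : coprime 24 p.
  rewrite coprime_sym prime_coprime // (_ : 24 = 2 ^ 3 * 3)%N //.
  rewrite Euclid_dvdM // Euclid_dvdX // !dvdn_prime2 //.
  by move: p5; clear; lia.
have /allP/(_ (p %% 24)%N) :
  all (fun r => coprime 24 r ==> (r ^ 2 %% 24 == 1)%N) (iota 0 24) by [].
rewrite mem_iota ltn_pmod // coprime_modr co modnXm => /(_ isT)/eqP p2.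
have -> : p%:Z ^+ 2 = (p ^ 2)%N by rewrite -rmorphXn /= ?natz.
lia.
Qed.

(** * Permutation of the Hecke cosets *)

(* [None] stands for the summand [f (p x)] of [T_p f]; its sign uses
   [-1 = zeta24 ^ 12]. *)
Definition hecke_mx (p : nat) (i : option 'I_p) : 'M[int]_2 :=
  if i is Some j then mx2 1 (j : nat)%:Z 0 p%:Z else mx2 p%:Z 0 0 1.

Definition hecke_exponent (p : nat) (i : option 'I_p) : int :=
  if i is Some j then - (p%:Z * (j : nat)%:Z)
  else 12 * ((p ^ 2 - 1) %/ 24)%N%:Z.

(** Distinct representatives lie in distinct cosets, which later makes the action on them injective.
    Comparing entries gives either two residues below [p] congruent modulo [p], or [p] dividing
    1. *)
Lemma hecke_mx_coset p (B : 'M[int]_2) (i k : option 'I_p) : (1 < p)%N ->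
  \det B = 1 -> hecke_mx i = B *m hecke_mx k -> i = k.
Proof.
move=> p_gt1; rewrite (mx2E B) det_mx2.
move: (B 0 0) (B 0 1) (B 1 0) (B 1 1) => {B} a b c d det1.
have mul_p x : 1 = x * p%:Z -> False.
  by move=> /(congr1 absz)/esym/eqP; rewrite abszM muln_eq1 => /andP[_ /eqP];
    lia.
case: i k => [j|] [k|] //=; rewrite mul_mx2 => /mx2_inj[];
  rewrite !(mulr0, mulr1, addr0, mul0r, add0r).
- move=> <- jE _ _; congr Some; apply: val_inj.
  have := congr1 (modz^~ p%:Z) jE; rewrite /= mul1r addrC modzMDl.
  by rewrite !modz_small; [case | rewrite ltz_nat ltn_ord..].
- by move=> /mul_p.
- by move=> _ _ <-; rewrite mul0r add0r => /mul_p.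
Qed.

(** * Action of the two generators on the Hecke cosets *)

Section HeckeSteps.
Variables (R : realType) (chi : 'M[int]_2 -> R[i]) (p : nat).
Hypotheses (chi_mult : multiplier_system 2 chi)
  (chi_T : chi (mx2 1 1 0 1) = zeta24 R)
  (chi_V : chi (mx2 1 0 2 1) = zeta24 R)
  (p_prime : prime p) (p_ge5 : (5 <= p)%N).

(** The last equation is the scalar identity that turns the summand of [i], slashed by [G], into
    [chi G ^+ p] times the summand of [k]. *)
Definition hecke_step (G : 'M[int]_2) (i k : option 'I_p) (B : 'M[int]_2) :=
  [/\ B \in Gamma0 2, hecke_mx i *m G = B *m hecke_mx k &
      zeta24 R ^ hecke_exponent i * chi B =
      chi G ^+ p * zeta24 R ^ hecke_exponent k].

(** All the scalars involved are powers of [zeta24], so the identity between them becomes a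
    congruence of exponents. *)
Lemma hecke_stepI G i k a b c e : chi G = zeta24 R ->
  a * (2 * e + 1) - b * (2 * c) = 1 ->
  hecke_mx i *m G = mx2 a b (2 * c) (2 * e + 1) *m hecke_mx k ->
  (24 %| hecke_exponent i + eta_exponent a b c e -
         (p%:Z + hecke_exponent k))%Z ->
  hecke_step G i k (mx2 a b (2 * c) (2 * e + 1)).
Proof.
move=> chiG det1 iGk mod24; split=> //;
  first by rewrite Gamma0P det1 eqxx dvdz_mulr.
rewrite (chi_etaE chi_mult chi_T chi_V det1) chiG exprnP.
by rewrite -!expfzDr ?zeta24_neq0 //; apply: zeta24_modX.
Qed.

Let p24 : (24 %| p%:Z ^+ 2 - 1)%Z := sqr_mod24 p_prime p_ge5.
(** As 24 divides [p ^ 2 - 1], the natural division in the exponent is exact. *)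
Let expNone : hecke_exponent (None : option 'I_p) * 2 = p%:Z ^+ 2 - 1.
Proof.
have E : p%:Z ^+ 2 = (p ^ 2)%N by rewrite -rmorphXn /= ?natz.
rewrite /= E; move: p24; rewrite E.
have : (0 < p ^ 2)%N by rewrite expn_gt0 prime_gt0.
by clear; lia.
Qed.

(** The index [j] moves to [j + 1] with [B = 1]. The last index wraps to 0 with [B = mx2 1 1 0 1],
    at the cost of [p ^ 2 - 1] in the exponent. [None] is fixed, [B] being the [p]-th power of
    [mx2 1 1 0 1]. *)
Lemma hecke_stepT i : exists k B, hecke_step (mx2 1 1 0 1) i k B.
Proof.
have p_gt0 := prime_gt0 p_prime.
case: i => [j|].
- have [jp|jp] := ltnP j.+1 p.
  + have kE : (nat_of_ord (Ordinal jp))%:Z = (j : nat)%:Z + 1.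
      by rewrite -PoszD addn1.
    exists (Some (Ordinal jp)); eexists; apply: (@hecke_stepI _ _ _ 1 0 0 0).
    * exact: chi_T.
    * by [].
    * by rewrite /hecke_mx kE !mul_mx2; congr mx2; ring.
    * by rewrite /hecke_exponent kE (_ : _ - _ = 0) ?dvdz0 // /eta_exponent;
        ring.
  + have kE : (nat_of_ord (Ordinal p_gt0))%:Z = 0 by [].
    have jE : (j : nat)%:Z = p%:Z - 1.
      by have := ltn_ord j; move: jp; clear; lia.
    exists (Some (Ordinal p_gt0)); eexists; apply: (@hecke_stepI _ _ _ 1 1 0 0).
    * exact: chi_T.
    * by [].
    * by rewrite /hecke_mx kE jE !mul_mx2; congr mx2; ring.
    * rewrite /hecke_exponent kE jE.
      rewrite (_ : _ - _ = - (p%:Z ^+ 2 - 1)) ?rpredN //.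
      by rewrite /eta_exponent; ring.
- exists None; eexists; apply: (@hecke_stepI _ _ _ 1 p%:Z 0 0).
  + exact: chi_T.
  + by ring.
  + by rewrite /hecke_mx !mul_mx2; congr mx2; ring.
  + by rewrite (_ : _ - _ = 0) ?dvdz0 // /eta_exponent; ring.
Qed.

(** The cosets are permuted like the projective line modulo [p] under [j |-> j / (1 + 2 j)], with
    [None] as infinity: the pole [(p - 1) / 2] goes to [None], and [None] goes to [1 / 2], that is
    to [(p + 1) / 2]. *)
Lemma hecke_stepV i : exists k B, hecke_step (mx2 1 0 2 1) i k B.
Proof.
have p_gt0 := prime_gt0 p_prime.
have p_odd : odd p by case: (even_prime p_prime) p_ge5 => [->|].
have expE x : p%:Z = 2 * x + 1 ->
    hecke_exponent (None : option 'I_p) = 2 * (x * (x + 1)).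
  move=> pE; have := expNone; rewrite pE.
  have -> : (2 * x + 1) ^+ 2 - 1 = 4 * (x * (x + 1)) by ring.
  by set y := x * _; lia.
case: i => [j|].
- have [pE|pNE] := eqVneq (j.*2.+1) p.
  + have {}pE : p%:Z = 2 * (j : nat)%:Z + 1 by move: pE; clear; lia.
    exists None; eexists.
    apply: (@hecke_stepI _ _ _ 1 (j : nat)%:Z 1 (j : nat)%:Z).
    * exact: chi_V.
    * by ring.
    * by rewrite /hecke_mx !mul_mx2 pE; congr mx2; ring.
    * rewrite (expE _ pE) /hecke_exponent.
      rewrite [X in (_ %| X)%Z](_ : _ = 2 * (p%:Z ^+ 2 - 1));
        first exact: dvdz_mull.
      by rewrite /eta_exponent pE; ring.
  + have [k kp [m mE]] : exists2 k : nat, (k < p)%N &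
        exists m : int, m * p%:Z = (j : nat)%:Z - k%:Z * (1 + 2 * (j : nat)%:Z).
      (* Since [2 j + 1 < 2 p], the only possible multiple of [p] is [p] itself, the case already
         treated. *)
      have co : coprime p j.*2.+1.
        rewrite prime_coprime //; apply/negP => /dvdnP[q qE].
        by move: qE pNE (ltn_ord j); case: q => [|[|q]]; clear; nia.
      have /coprimezP[[u v] /= uv] : coprimez p%:Z (1 + 2 * (j : nat)%:Z).
        by rewrite (_ : 1 + 2 * (j : nat)%:Z = j.*2.+1) //; clear; lia.
      have := divz_eq (v * (j : nat)%:Z) p%:Z.
      set t := (_ %/ _)%Z; set r := (_ %% _)%Z => rE.
      have p_neq0 : p%:Z != 0 by move: p_gt0; clear; lia.
      have r_ge0 : 0 <= r by exact: modz_ge0.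
      have r_ltp : r < p%:Z by rewrite ltz_mod.
      (* With [u p + v (1 + 2 j) = 1], the residue [r] of [v j] solves [k (1 + 2 j) = j] modulo [p];
         substituting [r = v j - t p] yields the quotient [m]. *)
      exists `|r|%N; first by move: r_ge0 r_ltp; clear; lia.
      exists (u * (j : nat)%:Z + t * (1 + 2 * (j : nat)%:Z)).
      have -> : `|r|%N%:Z = v * (j : nat)%:Z - t * p%:Z.
        by rewrite rE; move: r_ge0; clear; lia.
      rewrite -[X in X - _]mulr1 -[X in _ * X - _]uv; ring.
    have kE : (nat_of_ord (Ordinal kp))%:Z = k by [].
    exists (Some (Ordinal kp)); eexists.
    apply: (@hecke_stepI _ _ _ (1 + 2 * (j : nat)%:Z) m p%:Z (- k%:Z)).
    * exact: chi_V.
    * transitivity ((1 + 2 * (j : nat)%:Z) * (2 * - k%:Z + 1) - 2 * (m * p%:Z)).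
        by ring.
      by rewrite mE; ring.
    * rewrite /hecke_mx kE !mul_mx2 mE; congr mx2; ring.
    * rewrite /hecke_exponent kE.
      rewrite [X in (_ %| X)%Z](_ : _ = eta_exponent (1 + 2 * (j : nat)%:Z)
        m p%:Z (- k%:Z) - p%:Z * (1 + (j : nat)%:Z - k%:Z)); last by ring.
      exact: eta_exponent_coset.
- have hp : (p.+1./2 < p)%N by move: p_ge5; clear; lia.
  have pE : p%:Z = 2 * (p.+1./2)%:Z - 1 by move: p_odd; clear; lia.
  have hE : (nat_of_ord (Ordinal hp))%:Z = p.+1./2 by [].
  exists (Some (Ordinal hp)); eexists.
  apply: (@hecke_stepI _ _ _ p%:Z (- (p.+1./2)%:Z) 1 (-1)).
  + exact: chi_V.
  + by rewrite pE; ring.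
  + by rewrite /hecke_mx hE !mul_mx2; congr mx2; rewrite ?pE; ring.
  + rewrite (expE (p.+1./2%:Z - 1)) ?/hecke_exponent ?hE; last by rewrite pE;
      ring.
    rewrite [X in (_ %| X)%Z](_ : _ = p%:Z ^+ 2 - 1) //.
    by rewrite /eta_exponent pE; ring.
Qed.
End HeckeSteps.

(** * Smooth functions of a real variable *)

Section TimesDerivable.
Local Open Scope classical_set_scope.
Local Open Scope ring_scope.
Variable R : realType.
Implicit Types (D : set R) (u v : R -> R).

(** The first derivative is peeled off first, whereas [derive1n] adds the last one; inductions on
    the order can then pass from [u] to [derive1 u]. *)
Fixpoint times_derivable D n u : Prop :=
  if n is m.+1 then
    (forall y, D y -> derivable u y 1) /\ times_derivable D m (derive1 u)
  else True.

Lemma times_derivableP D u :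
  (forall n y, D y -> derivable (derive1n n u) y 1) <->
  forall n, times_derivable D n u.
Proof.
split=> [u_smooth n|u_smooth n].
- elim: n u u_smooth => //= n IHn u u_smooth; split.
    by move=> y Dy; exact: (u_smooth 0 y Dy).
  by apply: IHn => m y Dy; rewrite -derive1Sn; exact: u_smooth.
- elim: n u u_smooth => [|n IHn] u u_smooth y Dy.
    exact: (u_smooth 1).1.
  by rewrite derive1Sn; apply: IHn => // m; exact: (u_smooth m.+1).2.
Qed.

Lemma times_derivable_subset D D' n u :
  D' `<=` D -> times_derivable D n u -> times_derivable D' n u.
Proof.
move=> D'D; elim: n u => //= n IHn u [du du']; split; last exact: IHn.
by move=> y /D'D; exact: du.
Qed.

Lemma times_derivableW D n u :
  times_derivable D n.+1 u -> times_derivable D n u.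
Proof.
elim: n u => //= n IHn u [du du']; split => //; exact: IHn.
Qed.

Section OpenDomain.
Variables (D : set R) (D_open : open D).

(** Since [D] is open, equality on [D] is equality near each of its points, so derivatives agree as
    well. *)
Lemma eq_times_derivable n u v : (forall y, D y -> u y = v y) ->
  times_derivable D n u -> times_derivable D n v.
Proof.
elim: n u v => //= n IHn u v uv [du du'].
have near_uv y : D y -> \near y, u y = v y.
  move=> Dy; have : \near y, D y by exact: open_nbhs_nbhs.
  exact: filterS.
split=> [y Dy|]; first exact: near_eq_derivable (near_uv _ Dy) (du _ Dy).
apply: IHn du' => y Dy; rewrite !derive1E.
exact: near_eq_derive (near_uv _ Dy).
Qed.

(** This is the induction step of all closure lemmas below: a formula for the derivative valid on
    [D] lowers the order by one. *)
Lemma times_derivableS n u u' : (forall y, D y -> is_derive y 1 u (u' y)) ->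
  times_derivable D n u' -> times_derivable D n.+1 u.
Proof.
move=> du u'n; split=> [y Dy|]; first by have [] := du _ Dy.
apply: eq_times_derivable u'n => y Dy.
by have [_ <-] := du _ Dy; rewrite derive1E.
Qed.

Lemma times_derivable_is_derive n u y : times_derivable D n.+1 u ->
  D y -> is_derive y 1 u (derive1 u y).
Proof. by move=> [du _] Dy; rewrite derive1E; apply/derivableP/du. Qed.

Lemma times_derivable_cst n (k : R) : times_derivable D n (fun=> k).
Proof.
elim: n k => // n IHn k.
by apply: (@times_derivableS n _ (fun=> 0)).
Qed.

Lemma times_derivableD n u v : times_derivable D n u ->
  times_derivable D n v -> times_derivable D n (fun y => u y + v y).
Proof.
elim: n u v => // n IHn u v u_n v_n.
apply: (@times_derivableS n _ (fun y => derive1 u y + derive1 v y)).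
  move=> y Dy.
  have := is_deriveD (times_derivable_is_derive u_n Dy)
    (times_derivable_is_derive v_n Dy).
  exact.
by apply: IHn; [exact: u_n.2 | exact: v_n.2].
Qed.

Lemma times_derivableM n u v : times_derivable D n u ->
  times_derivable D n v -> times_derivable D n (fun y => u y * v y).
Proof.
elim: n u v => // n IHn u v u_n v_n.
apply: (@times_derivableS n _ (fun y => u y * derive1 v y + v y * derive1 u y)).
  move=> y Dy.
  have := is_deriveM (times_derivable_is_derive u_n Dy)
    (times_derivable_is_derive v_n Dy).
  exact.
apply: times_derivableD; apply: IHn.
- exact: times_derivableW.
- exact: v_n.2.
- exact: times_derivableW.
- exact: u_n.2.
Qed.

Variables (c d : R) (cd_neq0 : forall y, D y -> c * y + d != 0).

Let is_derive_affine (a b y : R) : is_derive y 1 (fun t => a * t + b) a.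
Proof.
have := is_deriveD (is_deriveZ a (is_derive_id y (1 : R)))
  (is_derive_cst b y 1).
move=> /is_derive_eq; apply.
by rewrite /GRing.scale /= mulr1 addr0.
Qed.

Let is_derive_inv_affine y : D y ->
  is_derive y 1 (fun t => (c * t + d)^-1)
    (- c * ((c * y + d)^-1 * (c * y + d)^-1)).
Proof.
move=> Dy.
have := is_deriveV (cd_neq0 Dy : (fun t => c * t + d) y != 0)
  (is_derive_affine c d y).
move=> /is_derive_eq; apply.
by rewrite /GRing.scale /= expr2 invfM; ring.
Qed.

(* With [w = (c y + d)^-1], the equations [w' = - c w ^ 2] and
   [|w|' = - c w |w|] close the inductions on [n]. *)
Lemma times_derivable_inv_affine n :
  times_derivable D n (fun y => (c * y + d)^-1).
Proof.
elim: n => // n IHn.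
apply: times_derivableS is_derive_inv_affine _.
apply: times_derivableM; first exact: times_derivable_cst.
exact: times_derivableM.
Qed.

Lemma times_derivable_norm_inv_affine n :
  times_derivable D n (fun y => `|c * y + d|^-1).
Proof.
elim: n => // n IHn.
apply: (@times_derivableS n _ (fun y =>
  - c * ((c * y + d)^-1 * `|c * y + d|^-1))).
  move=> y Dy.
  have cont : (fun t => c * t + d) @ y --> c * y + d.
    have : {for y, continuous (fun t => c * t + d)}; last by [].
    apply: differentiable_continuous; apply/derivable1_diffP.
    by have [] := is_derive_affine c d y.
  (* By continuity the sign of [c t + d] is constant near [y], so the absolute value is locally the
     identity or the opposite. *)
  have [pos|neg|eq0] := ltgtP 0 (c * y + d); last by have := cd_neq0 Dy;
    rewrite -eq0 eqxx.
  - have near_pos : \near y, (c * y + d)^-1 = `|c * y + d|^-1.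
      have : \near y, 0 < c * y + d by exact: (cvgr_gt _ cont _ pos).
      by apply: filterS => t /ltW/ger0_norm->.
    apply: near_eq_is_derive near_pos _; rewrite (gtr0_norm pos).
    exact: is_derive_inv_affine.
  - have near_neg : \near y, - (c * y + d)^-1 = `|c * y + d|^-1.
      have : \near y, c * y + d < 0 by exact: (cvgr_lt _ cont _ neg).
      by apply: filterS => t /ltW/ler0_norm->; rewrite invrN.
    apply: near_eq_is_derive near_neg _; rewrite (ltr0_norm neg) invrN !mulrN.
    have := is_deriveN (is_derive_inv_affine Dy).
    exact.
apply: times_derivableM; first exact: times_derivable_cst.
apply: times_derivableM => //; exact: times_derivable_inv_affine.
Qed.

(** By the chain rule the derivative is [derive1 u] composed with the same map, times
    [(a d - b c) / (c y + d) ^ 2]; the first factor is covered by induction. *)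
Lemma times_derivable_comp_moebius (a b : R) (D' : set R) n u :
  (forall y, D y -> D' ((a * y + b) / (c * y + d))) ->
  times_derivable D' n u ->
  times_derivable D n (fun y => u ((a * y + b) / (c * y + d))).
Proof.
move=> DD'; elim: n u => // n IHn u u_n.
apply: (@times_derivableS n _ (fun y => derive1 u ((a * y + b) / (c * y + d)) *
   ((a * d - b * c) * ((c * y + d)^-1 * (c * y + d)^-1)))).
  move=> y Dy.
  apply: (@is_derive1_comp R u (fun t => (a * t + b) / (c * t + d))).
    by rewrite derive1E; apply/derivableP/u_n.1/DD'.
  have := is_deriveM (is_derive_affine a b y) (is_derive_inv_affine Dy).
  move=> /is_derive_eq; apply; rewrite /GRing.scale /=.
  by have := cd_neq0 Dy => ?; field.
apply: times_derivableM; first by apply: IHn; exact: u_n.2.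
apply: times_derivableM; first exact: times_derivable_cst.
by apply: times_derivableM; exact: times_derivable_inv_affine.
Qed.

End OpenDomain.
End TimesDerivable.

(** * Functions that are smooth off a finite set *)

Section SmoothOffFinite.
Local Open Scope classical_set_scope.
Local Open Scope ring_scope.
Variable R : realType.
Implicit Types (S : set rat) (f h : rat -> R[i]) (g : R -> R[i]).

Let off S : set R := ~` [set ratr q | q in S].

Let open_off S : finite_set S -> open (off S).
Proof.
move=> S_fin; apply: closed_openC.
apply: (accessible_finite_set_closed.1 _); last exact: finite_image.
exact/hausdorff_accessible/norm_hausdorff.
Qed.

Let off_subset S S' : S `<=` S' -> off S' `<=` off S.
Proof. by move=> SS' y S'y [q /SS' S'q qy]; apply: S'y; exists q. Qed.

Lemma smooth_onP (D : set R) g : smooth_on D g <-> forall n,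
  times_derivable D n (fun t => complex.Re (g t)) /\
  times_derivable D n (fun t => complex.Im (g t)).
Proof.
split=> [g_smooth n|g_n n y Dy].
- by split; apply: (times_derivableP _ _).1 => m y Dy;
    have [] := g_smooth m y Dy.
- by split; apply: (times_derivableP _ _).2 Dy => m; have [] := g_n m.
Qed.

Definition smooth_off_finite h := exists S g,
  [/\ finite_set S, smooth_on (off S) g & forall x, ~ S x -> g (ratr x) = h x].

Lemma eq_smooth_off_finite S h h' : finite_set S ->
  (forall x, ~ S x -> h x = h' x) ->
  smooth_off_finite h -> smooth_off_finite h'.
Proof.
move=> S_fin hh' [S0 [g [S0_fin /smooth_onP g_smooth gh]]].
exists (S0 `|` S), g; split; first by rewrite finite_setU.
- apply/smooth_onP => n; have [g1 g2] := g_smooth n.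
  split.
  + by apply: times_derivable_subset g1; apply: off_subset => ?; left.
  + by apply: times_derivable_subset g2; apply: off_subset => ?; left.
- by move=> x /not_orP[? ?]; rewrite gh ?hh'.
Qed.

Lemma smooth_off_finite0 : smooth_off_finite (fun=> 0).
Proof.
exists set0, (fun=> 0); split=> //; apply/smooth_onP => n.
by split; apply: times_derivable_cst; apply: open_off.
Qed.

Lemma smooth_off_finiteD h h' : smooth_off_finite h -> smooth_off_finite h' ->
  smooth_off_finite (fun x => h x + h' x).
Proof.
move=> [S [g [S_fin /smooth_onP g_smooth gh]]].
move=> [S' [g' [S'_fin /smooth_onP g'_smooth gh']]].
exists (S `|` S'), (fun t => g t + g' t).
have SS'_fin : finite_set (S `|` S') by rewrite finite_setU.
have subl : off (S `|` S') `<=` off S by apply: off_subset => ?; left.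
have subr : off (S `|` S') `<=` off S' by apply: off_subset => ?; right.
split=> //; last by move=> x /not_orP[? ?]; rewrite gh ?gh'.
apply/smooth_onP => n; have [g1 g2] := g_smooth n;
  have [g'1 g'2] := g'_smooth n.
split.
- have -> : (fun t => complex.Re (g t + g' t)) =
            (fun t => complex.Re (g t) + complex.Re (g' t)).
    by apply/funext => t; case: (g t); case: (g' t).
  apply: times_derivableD (open_off SS'_fin) _ _ _ _ _.
  + exact: times_derivable_subset g1.
  + exact: times_derivable_subset g'1.
- have -> : (fun t => complex.Im (g t + g' t)) =
            (fun t => complex.Im (g t) + complex.Im (g' t)).
    by apply/funext => t; case: (g t); case: (g' t).
  apply: times_derivableD (open_off SS'_fin) _ _ _ _ _.
  + exact: times_derivable_subset g2.
  + exact: times_derivable_subset g'2.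
Qed.

Lemma smooth_off_finiteZ (k : R[i]) h : smooth_off_finite h ->
  smooth_off_finite (fun x => k * h x).
Proof.
move=> [S [g [S_fin /smooth_onP g_smooth gh]]].
exists S, (fun t => k * g t); split=> // [|x Sx]; last by rewrite gh.
apply/smooth_onP => n; have [g1 g2] := g_smooth n.
have oS := open_off S_fin.
have cst (x : R) : times_derivable (off S) n (fun=> x).
  exact: times_derivable_cst.
case: k => a b; split.
- have -> : (fun t => complex.Re (Complex a b * g t)) =
            (fun t => a * complex.Re (g t) + (- b) * complex.Im (g t)).
    by apply/funext => t; case: (g t) => u v; simpc.
  by apply: times_derivableD => //; exact: times_derivableM.
- have -> : (fun t => complex.Im (Complex a b * g t)) =
            (fun t => a * complex.Im (g t) + b * complex.Re (g t)).
    by apply/funext => t; case: (g t) => u v; simpc.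
  by apply: times_derivableD => //; exact: times_derivableM.
Qed.

Lemma smooth_off_finite_sum (I : finType) (h : I -> rat -> R[i]) :
  (forall i, smooth_off_finite (h i)) ->
  smooth_off_finite (fun x => \sum_i h i x).
Proof.
move=> h_smooth.
have -> : (fun x => \sum_i h i x) = \sum_i h i by apply/funext => x;
  rewrite fct_sumE.
elim/big_rec: _ => [|i u _]; first exact: smooth_off_finite0.
exact: smooth_off_finiteD.
Qed.

(** No power of the determinant enters. At a pole of [A] the value is 0, because the inverse of 0 is
    0. *)
Definition slash (A : 'M[int]_2) f x : R[i] :=
  ratr `|auto_factor A x|^-1 * f (moebius A x).

Lemma finite_zeros_auto_factor (A : 'M[int]_2) : \det A != 0 ->
  finite_set [set x | auto_factor A x = 0].
Proof.
move=> detA.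
apply: (@sub_finite_set _ _ [set - (A 1 1)%:~R / (A 1 0)%:~R]) => // x /=.
rewrite /auto_factor; have [c0|c_neq0] := eqVneq (A 1 0) 0.
  rewrite c0 mul0r add0r => /eqP; rewrite intr_eq0 => /eqP d0.
  by move: detA; rewrite (mx2E A) det_mx2 c0 d0 !mulr0 subrr eqxx.
move=> /eqP; rewrite addr_eq0 => /eqP <-.
by rewrite mulrC mulKf // intr_eq0.
Qed.

(** The new exceptional set consists of the pole of [A] and the preimages under [A] of the old one;
    off it, both the factor and the composite are smooth. *)
Lemma smooth_off_finite_slash (A : 'M[int]_2) h : \det A != 0 ->
  smooth_off_finite h -> smooth_off_finite (slash A h).
Proof.
move=> detA [S [g [S_fin /smooth_onP g_smooth gh]]].
pose a : R := (A 0 0)%:~R; pose b : R := (A 0 1)%:~R.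
pose c : R := (A 1 0)%:~R; pose d : R := (A 1 1)%:~R.
have adbc : a * d - b * c != 0.
  by rewrite /a /b /c /d -!intrM -rmorphB intr_eq0 -det_mx2 -mx2E.
(* If [c = 0] then [pole] is [0], which merely enlarges [S']. *)
pose pole : rat := - (A 1 1)%:~R / (A 1 0)%:~R.
(* If [a = c s], no finite point is mapped to [s], and the default value 0 merely enlarges [S']. *)
pose Ainv (s : rat) : rat :=
  ((A 1 1)%:~R * s - (A 0 1)%:~R) / ((A 0 0)%:~R - (A 1 0)%:~R * s).
pose S' := [set pole] `|` [set Ainv s | s in S].
have S'_fin : finite_set S'.
  by rewrite finite_setU; split; [exact: finite_set1 | exact: finite_image].
have oS' := open_off S'_fin.
have cd_neq0 y : off S' y -> c * y + d != 0.
  move=> S'y; apply/negP => /eqP cyd; apply: S'y; exists pole; first by left.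
  rewrite /pole fmorph_div rmorphN /= !ratr_int -/c -/d.
  have c_neq0 : c != 0.
    apply/negP => /eqP c0; move: cyd adbc; rewrite c0 mul0r add0r => ->.
    by rewrite !mulr0 subrr eqxx.
  by rewrite -(mulKf c_neq0 y) mulrC; congr (_ * _); lra.
have mob_off y : off S' y -> off S ((a * y + b) / (c * y + d)).
  move=> S'y; have cyd := cd_neq0 _ S'y => -[s Ss sE]; apply: S'y.
  exists (Ainv s); first by right; exists s.
  rewrite /Ainv fmorph_div !(rmorphB, rmorphM) /= !ratr_int -/a -/b -/c -/d sE.
  (* The denominator of [Ainv] is nonzero at a value actually attained, so [Ainv] does recover
     [y]. *)
  have acs : a - c * ((a * y + b) / (c * y + d)) =
      (a * d - b * c) / (c * y + d) by field.
  by rewrite acs; field; rewrite adbc cyd.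
have ratr_moebius x :
    ratr (moebius A x) = (a * ratr x + b) / (c * ratr x + d) :> R.
  by rewrite /moebius /auto_factor fmorph_div !(rmorphD, rmorphM) /= !ratr_int.
have ratr_auto x : ratr `|auto_factor A x|^-1 = `|c * ratr x + d|^-1 :> R.
  by rewrite fmorphV /= ratr_norm /auto_factor !(rmorphD, rmorphM) /= !ratr_int.
pose gA t := real_complex R `|c * t + d|^-1 * g ((a * t + b) / (c * t + d)).
exists S'; exists gA.
split=> //.
- apply/smooth_onP => n; have [g1 g2] := g_smooth n.
  pose re_g t := complex.Re (g t); pose im_g t := complex.Im (g t).
  have w_n := times_derivable_norm_inv_affine oS' cd_neq0 n.
  split.
  + have -> : (fun t => complex.Re (gA t)) =
              (fun t => `|c * t + d|^-1 * re_g ((a * t + b) / (c * t + d))).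
      by apply/funext => t; rewrite /gA /re_g /im_g; case: (g _) => u v; simpc.
    apply: times_derivableM => //.
    exact: (times_derivable_comp_moebius oS' cd_neq0 mob_off g1).
  + have -> : (fun t => complex.Im (gA t)) =
              (fun t => `|c * t + d|^-1 * im_g ((a * t + b) / (c * t + d))).
      by apply/funext => t; rewrite /gA /re_g /im_g; case: (g _) => u v; simpc.
    apply: times_derivableM => //.
    exact: (times_derivable_comp_moebius oS' cd_neq0 mob_off g2).
- move=> x S'x; rewrite /gA /slash -ratr_moebius -ratr_auto gh.
    by rewrite -[RHS]/(_ * _) fmorph_rat.
  move=> Sx; apply: (mob_off (ratr x)); last by exists (moebius A x) => //;
    exact: ratr_moebius.
  by move=> [q S'q /(fmorph_inj _) qx]; apply: S'x; rewrite -qx.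
Qed.

End SmoothOffFinite.

(** * Slash action modulo smooth functions *)

Section Slash.
Local Open Scope classical_set_scope.
Local Open Scope ring_scope.
Variable R : realType.
Implicit Types (f g h : rat -> R[i]) (A B : 'M[int]_2) (k : R[i]).

Definition eq_mod_smooth f g := smooth_off_finite (fun x => f x - g x).

Lemma eq_mod_smooth_off S f g :
  finite_set S -> (forall x, ~ S x -> f x = g x) ->
  eq_mod_smooth f g.
Proof.
move=> S_fin fg; apply: eq_smooth_off_finite S_fin _ (smooth_off_finite0 R).
by move=> x Sx; rewrite fg // subrr.
Qed.

Lemma smooth_off_finite_ext h h' : h =1 h' ->
  smooth_off_finite h -> smooth_off_finite h'.
Proof.
by move=> hh'; apply: eq_smooth_off_finite (@finite_set0 _) _ => x _;
  apply: hh'.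
Qed.

Lemma eq_mod_smooth1 f g : f =1 g -> eq_mod_smooth f g.
Proof. by move=> fg; apply: (@eq_mod_smooth_off set0) => // x _. Qed.

Lemma eq_mod_smooth_sym f g : eq_mod_smooth f g -> eq_mod_smooth g f.
Proof.
move=> /(smooth_off_finiteZ (-1)); apply: smooth_off_finite_ext => x.
by rewrite mulN1r opprB.
Qed.

Lemma eq_mod_smooth_trans g f h :
  eq_mod_smooth f g -> eq_mod_smooth g h -> eq_mod_smooth f h.
Proof.
move=> fg gh; apply: smooth_off_finite_ext (smooth_off_finiteD fg gh) => x.
by rewrite addrA subrK.
Qed.

Lemma eq_mod_smoothZ k f g : eq_mod_smooth f g ->
  eq_mod_smooth (fun x => k * f x) (fun x => k * g x).
Proof.
move=> /(smooth_off_finiteZ k); apply: smooth_off_finite_ext => x.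
by rewrite mulrBr.
Qed.

Lemma eq_mod_smooth_sum (I : finType) (f g : I -> rat -> R[i]) :
  (forall i, eq_mod_smooth (f i) (g i)) ->
  eq_mod_smooth (fun x => \sum_i f i x) (fun x => \sum_i g i x).
Proof.
move=> /smooth_off_finite_sum; apply: smooth_off_finite_ext => x.
by rewrite sumrB.
Qed.

Lemma eq_mod_smooth_slash A f g : \det A != 0 -> eq_mod_smooth f g ->
  eq_mod_smooth (slash A f) (slash A g).
Proof.
move=> detA /(smooth_off_finite_slash detA); apply: smooth_off_finite_ext => x.
by rewrite /slash mulrBr.
Qed.

Lemma slashZ A k f : slash A (fun x => k * f x) =1 (fun x => k * slash A f x).
Proof. by move=> x; rewrite /slash mulrCA. Qed.

Lemma slash_sum A (I : finType) (f : I -> rat -> R[i]) :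
  slash A (fun x => \sum_i f i x) =1 (fun x => \sum_i slash A (f i) x).
Proof. by move=> x; rewrite /slash mulr_sumr. Qed.

(** The cocycle relation for [c x + d] gives equality wherever [B] has no pole; if [A] has a pole at
    the image of [x], both sides are 0. *)
Lemma slashM A B f : \det B != 0 ->
  eq_mod_smooth (slash (A *m B) f) (slash B (slash A f)).
Proof.
move=> detB; apply: eq_mod_smooth_off (finite_zeros_auto_factor detB) _ =>
  x /= /eqP Bx.
have mulE i j : ((A *m B) i j)%:~R =
    (A i 0)%:~R * (B 0 j)%:~R + (A i 1)%:~R * (B 1 j)%:~R :> rat.
  rewrite mxE big_ord_recl big_ord1 rmorphD !rmorphM /=.
  by congr (_ + (A _ _)%:~R * (B _ _)%:~R); apply: val_inj.
have mulBx i : ((A *m B) i 0)%:~R * x + ((A *m B) i 1)%:~R =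
    ((A i 0)%:~R * moebius B x + (A i 1)%:~R) * auto_factor B x.
  have mobB : moebius B x * auto_factor B x = (B 0 0)%:~R * x + (B 0 1)%:~R.
    by rewrite divfK.
  by rewrite mulrDl -mulrA mobB !mulE /auto_factor; ring.
have autoM : auto_factor (A *m B) x =
    auto_factor A (moebius B x) * auto_factor B x := mulBx 1.
have mobM : moebius (A *m B) x = moebius A (moebius B x).
  by rewrite {1}/moebius autoM mulBx -mulf_div divff // mulr1.
rewrite /slash mobM autoM normrM invfM rmorphM /=.
by rewrite -mulrA mulrCA.
Qed.

Lemma slash1 f : slash 1%:M f =1 f.
Proof.
move=> x; rewrite -mx2_1 /slash /moebius /auto_factor !mxE /=.
by rewrite !mul0r !add0r normr1 invr1 rmorph1 !mul1r addr0 divr1.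
Qed.

Lemma Gamma0_det N A : A \in Gamma0 N -> \det A = 1.
Proof. by move=> /andP[/eqP]. Qed.

Lemma Gamma0_det_neq0 N A : A \in Gamma0 N -> \det A != 0.
Proof. by move=> /Gamma0_det->. Qed.

(** The period function is [- (psi A)^-1] times [slash A f - psi A * f], a nonzero scalar
    multiple. *)
Lemma quantum_modularP N (psi : 'M[int]_2 -> R[i]) f :
  quantum_modular N psi f <->
  multiplier_system N psi /\
  {in Gamma0 N, forall A, eq_mod_smooth (slash A f) (fun x => psi A * f x)}.
Proof.
suff equiv A : psi A != 0 -> A \in Gamma0 N ->
    (exists (S : set rat) (g : R -> R[i]),
      [/\ finite_set S, smooth_on (~` [set ratr q | q in S]) g &
          forall x : rat, ~ S x -> auto_factor A x != 0 ->
            g (ratr x) = period_fun psi f A x]) <->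
    eq_mod_smooth (slash A f) (fun x => psi A * f x).
  split=> -[psi_mult H]; split=> // A GA; have [psi_norm _] := psi_mult.
  - have psiA : psi A != 0 by rewrite -normr_gt0 psi_norm ?ltr01.
    by apply/(equiv A psiA GA); exact: H.
  - have psiA : psi A != 0 by rewrite -normr_gt0 psi_norm ?ltr01.
    by apply/(equiv A psiA GA); exact: H.
move=> psiA GA; split.
- move=> [S [g [S_fin g_smooth gE]]].
  (* The definition leaves [g] free at the pole of [A], so the period function is first replaced
     there by [g]; this changes it at finitely many points only. *)
  have : smooth_off_finite (fun x =>
    if auto_factor A x == 0 then g (ratr x) else period_fun psi f A x).
    exists S, g; split=> // x Sx; case: ifP => // /negbT; exact: gE.
  have zeros_fin := finite_zeros_auto_factor (Gamma0_det_neq0 GA).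
  move=> /(eq_smooth_off_finite zeros_fin) H.
  have {H} /(smooth_off_finiteZ (- psi A)) :
    smooth_off_finite (period_fun psi f A).
    by apply: H => x /= /eqP/negbTE->.
  apply: smooth_off_finite_ext => x.
  by rewrite /period_fun -[(psi A)^-1 * _ * _]mulrA mulNr mulrBr opprB mulVKf.
- move=> /(smooth_off_finiteZ (- (psi A)^-1)) [S [g [S_fin g_smooth gE]]].
  exists S, g; split=> // x Sx _; rewrite gE // mulNr mulrBr opprB mulKf //.
  by rewrite /period_fun -mulrA.
Qed.

Lemma sum_option (I : finType) (F : option I -> R[i]) :
  \sum_i F i = F None + \sum_j F (Some j).
Proof.
rewrite (bigD1 None) //=; congr (_ + _).
rewrite (reindex_omap Some id) /=; last by case.
by apply: eq_bigl => j; rewrite eqxx.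
Qed.

(** The factor [1 / p] in front of the sum is the automorphy factor of the matrices with lower row
    [(0, p)]. *)
Lemma hecke_inftyE p f : (0 < p)%N -> hecke_infty p f =1
  (fun x => \sum_(i : option 'I_p)
     zeta24 R ^ hecke_exponent i * slash (hecke_mx i) f x).
Proof.
move=> p_gt0 x; rewrite sum_option /hecke_infty; congr (_ + _).
  rewrite /slash /moebius /auto_factor /hecke_mx !mxE /=.
  rewrite mul0r add0r addr0 normr1 invr1 rmorph1 mul1r divr1; congr (_ * _).
  by rewrite -exprz_exp -!exprnP zeta24_12.
rewrite mulr_sumr; apply: eq_bigr => j _.
rewrite /slash /moebius /auto_factor /hecke_mx !mxE /=.
rewrite !mul0r !add0r mul1r mulrCA; congr (_ * (_ * _)).
- by rewrite -exprz_inv -exprnP exprVn.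
- by rewrite normr_nat fmorphV /= ratr_nat.
Qed.
End Slash.

(** * Hecke operators preserve modularity *)

(** Modularity passes to products by the slash action and to inverses, hence from the two generators
    to the whole group. *)
Lemma quantum_modular_generators (R : realType) (psi : 'M[int]_2 -> R[i]) f :
  multiplier_system 2 psi ->
  {in [:: mx2 1 1 0 1; mx2 1 0 2 1], forall G,
    eq_mod_smooth (slash G f) (fun x => psi G * f x)} ->
  quantum_modular 2 psi f.
Proof.
move=> psi_mult f_gen; apply/quantum_modularP; split=> //.
have [_ psiM] := psi_mult; have psi1 := multiplier_system1 psi_mult.
pose P A := eq_mod_smooth (slash A f) (fun x => psi A * f x).
have PM A B : A \in Gamma0 2 -> B \in Gamma0 2 -> P B -> P A -> P (A *m B).
  move=> GA GB PB PA; have detB := Gamma0_det_neq0 GB.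
  apply: eq_mod_smooth_trans (slashM A f detB) _.
  apply: eq_mod_smooth_trans (eq_mod_smooth_slash detB PA) _.
  apply: eq_mod_smooth_trans (eq_mod_smooth1 (slashZ _ _ _)) _.
  apply: eq_mod_smooth_trans (eq_mod_smoothZ (psi A) PB) _.
  by apply: eq_mod_smooth1 => x; rewrite psiM // mulrA.
have PV A B : A \in Gamma0 2 -> B \in Gamma0 2 -> A *m B = 1%:M -> P A -> P B.
  move=> GA GB AB PA; have detB := Gamma0_det_neq0 GB.
  have psiAB : psi A * psi B = 1 by rewrite -psiM // AB psi1.
  (* Slashing the relation for [A] by its inverse [B] gives [f] on one side and [psi A] times
     [slash B f] on the other. *)
  have fBA : eq_mod_smooth (fun x => psi A * slash B f x) f.
    apply: eq_mod_smooth_trans (eq_mod_smooth1 (fsym (slashZ _ _ _))) _.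
    apply: eq_mod_smooth_trans _ _;
      first exact: eq_mod_smooth_sym (eq_mod_smooth_slash detB PA).
    apply: eq_mod_smooth_trans (eq_mod_smooth_sym (slashM A f detB)) _.
    by rewrite AB; apply: eq_mod_smooth1; exact: slash1.
  apply: eq_mod_smooth_trans (eq_mod_smoothZ (psi B) fBA).
  by apply: eq_mod_smooth1 => x; rewrite mulrA [psi B * _]mulrC psiAB mul1r.
have GT : mx2 1 1 0 1 \in Gamma0 2 by rewrite Gamma0P.
have GTi : mx2 1 (-1) 0 1 \in Gamma0 2 by rewrite Gamma0P.
have GV : mx2 1 0 2 1 \in Gamma0 2 by rewrite Gamma0P.
have GVi : mx2 1 0 (-2) 1 \in Gamma0 2 by rewrite Gamma0P.
have PT : P (mx2 1 1 0 1) by apply: f_gen; rewrite mem_head.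
have PW : P (mx2 1 0 2 1) by apply: f_gen; rewrite !inE eqxx orbT.
have PTi : P (mx2 1 (-1) 0 1).
  by apply: PV PT => //; rewrite mul_mx2 -mx2_1.
have PWi : P (mx2 1 0 (-2) 1).
  by apply: PV PW => //; rewrite mul_mx2 -mx2_1.
apply: Gamma0_2_ind; try by move=> A GA PA; apply: PM.
by apply: eq_mod_smooth1 => x; rewrite slash1 psi1 mul1r.
Qed.

Lemma hecke_step_modular (R : realType) (chi : 'M[int]_2 -> R[i]) p f
    (G : 'M[int]_2) :
  prime p -> quantum_modular 2 chi f -> G \in Gamma0 2 ->
  (forall i : option 'I_p, exists k B, hecke_step chi G i k B) ->
  eq_mod_smooth (slash G (hecke_infty p f))
    (fun x => chi G ^+ p * hecke_infty p f x).
Proof.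
move=> p_prime /quantum_modularP[chi_mult f_qm] GG stepE.
have p_gt0 := prime_gt0 p_prime.
have {stepE} [pi step] : exists pi : option 'I_p -> option 'I_p,
    forall i, exists B, hecke_step chi G i (pi i) B.
  by have [pi] := fin_all_exists stepE; exists pi.
have detG := Gamma0_det_neq0 GG.
have Gunit : G \in unitmx by rewrite unitmxE (Gamma0_det GG) unitr1.
(* If [i] and [i'] have the same image, then [hecke_mx i] is [B *m invmx B'] times [hecke_mx i'], so
   they represent the same coset. *)
have pi_inj : injective pi.
  move=> i i' pi_eq.
  have [B [GB iE _]] := step i; have [B' [GB' i'E _]] := step i'.
  have B'unit : B' \in unitmx by rewrite unitmxE (Gamma0_det GB') unitr1.
  apply: (@hecke_mx_coset _ (B *m invmx B') _ _ (prime_gt1 p_prime)).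
    by rewrite det_mulmx det_inv (Gamma0_det GB) (Gamma0_det GB') invr1 mulr1.
  apply: (can_inj (mulmxK Gunit)).
  by rewrite iE -[RHS]mulmxA i'E -mulmxA mulKmx // pi_eq.
have det_hecke (i : option 'I_p) : \det (hecke_mx i) != 0.
  by case: i => [j|]; rewrite det_mx2 ?mul1r ?mulr1 ?mulr0 ?subr0; move: p_gt0;
    clear; lia.
pose F i x := zeta24 R ^ hecke_exponent i * slash (@hecke_mx p i) f x.
have FE : hecke_infty p f =1 (fun x => \sum_i F i x) := hecke_inftyE f p_gt0.
apply: (@eq_mod_smooth_trans _ (slash G (fun x => \sum_i F i x))).
  by apply: eq_mod_smooth_slash => //; exact: eq_mod_smooth1.
apply: (@eq_mod_smooth_trans _ (fun x => \sum_i chi G ^+ p * F (pi i) x));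
  last first.
  apply: eq_mod_smooth1 => x; rewrite FE -mulr_sumr; congr (_ * _).
  (* An injective self-map of a finite set is a permutation, so the full sum reappears. *)
  by rewrite [RHS](reindex_inj pi_inj).
apply: eq_mod_smooth_trans (eq_mod_smooth1 (slash_sum _ _)) _.
apply: eq_mod_smooth_sum => i; have [B [GB iE coefE]] := step i.
apply: eq_mod_smooth_trans (eq_mod_smooth1 (slashZ _ _ _)) _.
apply: eq_mod_smooth_trans
  (eq_mod_smoothZ _ (eq_mod_smooth_sym (slashM _ _ detG))) _.
rewrite iE.
apply: eq_mod_smooth_trans (eq_mod_smoothZ _ (slashM _ _ (det_hecke _))) _.
apply: eq_mod_smooth_trans (eq_mod_smoothZ _
  (eq_mod_smooth_slash (det_hecke _) (f_qm _ GB))) _.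
by apply: eq_mod_smooth1 => x; rewrite slashZ [LHS]mulrA coefE -mulrA.
Qed.

Theorem theorem1p2 (R : realType) (chi : 'M[int]_2 -> R[i])
    (f : rat -> R[i]) (p : nat)
    (chi_mult : multiplier_system 2 chi)
    (chi_T : chi (mx2 1 1 0 1) = zeta24 R)
    (chi_V : chi (mx2 1 0 2 1) = zeta24 R)
    (f_qm : quantum_modular 2 chi f)
    (p_prime : prime p) (p_ge5 : (5 <= p)%N) (p_le757 : (p <= 757)%N) :
  quantum_modular 2 (fun A => chi A ^+ p) (hecke_infty p f).
Proof.
apply: quantum_modular_generators.
- have [chi_norm chiM] := chi_mult; split=> [A GA|A B GA GB] /=.
    by rewrite normrX chi_norm // expr1n.
  by rewrite chiM // exprMn.
- move=> G; rewrite !inE => /orP[] /eqP->; apply: hecke_step_modular => //;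
    rewrite ?Gamma0P //.
  + exact: hecke_stepT.
  + exact: hecke_stepV.
Qed.
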